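(* Let $A(t)$ be a curve in the space of twisted polygons, let $T$ be the pentagram map, and let $B(t)=T(A(t))$ for all $t$. Let $\mathcal{A}$ and $\mathcal{B}$ be the corresponding decorations of $A=A(0)$ and $B=B(0)$ respectively, i.e. the decorated polygons induced by the curves $A(t)$ and $B(t)$. Then $\mathcal{B}$ is uniquely determined by $\mathcal{A}$.
   Context: Work in the projective plane; $\overleftrightarrow{PQ}$ is the line through $P,Q$. A twisted polygon (twisted $n$-gon) is a sequence $A=(A_i)$ of points indexed by $\mathbb{Z}$ or by $\frac12+\mathbb{Z}$ with $A_{i+n}=\phi(A_i)$ for all $i$, for some projective transformation $\phi$, such that every four consecutive points are in general position. (Actual twisted polygons are used, not projective equivalence classes.) Its sides are $a_j=\overleftrightarrow{A_{j-1/2}A_{j+1/2}}$, indexed by the opposite indexing set. The pentagram map $T$ sends $A$ to the polygon $B$ with sides $b_i=\overleftrightarrow{A_{i-1}A_{i+1}}$ and vertices $B_j=b_{j-1/2}\cap b_{j+1/2}$. Decorations: if $\gamma$ is a smooth curve of points with $\gamma(0)=P$, the associated decoration of the point $P$ is, when defined, the line $P^*=\lim_{t\to0}\overleftrightarrow{P\,\gamma(t)}$ through $P$ (the tangent line of $\gamma$ at $P$). If $\gamma$ is a curve of lines (a curve in the dual plane) with $\gamma(0)=l$, the associated decoration of the line $l$ is, when defined, the point $l^*=\lim_{t\to0}l\cap\gamma(t)$ on $l$. A curve in the space of twisted polygons passing through $A$ at $t=0$ determines a curve through each vertex of $A$ and a curve in the dual plane through each side of $A$, hence decorations of all the vertices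 and sides. A decorated polygon is a twisted polygon together with the decorations of each of its vertices and sides induced by some such curve.
   Formalization: Added, as the claim fails in degenerate cases: no vertex decoration of A is a side through that vertex, no side decoration is an endpoint of that side; never A_{i-1}^* = b_i = A_{i+1}^*, nor b_{j-1/2}^* = B_j = b_{j+1/2}^*. *)

(* Defs.v *)
From HB Require Import structures.
From mathcomp Require Import all_boot all_order all_algebra.
From mathcomp Require Import all_classical all_reals all_analysis.
Import Order.TTheory GRing.Theory Num.Theory.
Import numFieldNormedType.Exports.

Set Implicit Arguments.
Unset Strict Implicit.
Unset Printing Implicit Defensive.

Local Open Scope classical_set_scope.
Local Open Scope ring_scope.

(* Points and lines of the real projective plane are the linear subspaces of
   R^3 of dimension 1 and 2, so that incidence is <=, the line through two
   distinct points is their sum, and the common point of two distinct lines is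
   their intersection. *)
Notation flat R := {vspace 'rV[R]_3}.

Definition is_point (R : realType) (P : flat R) : Prop := \dim P = 1%N.

Definition noncollinear (R : realType) (P Q S : flat R) : Prop :=
  \dim (P + Q + S) = 3%N.

Definition general_position (R : realType) (P Q S U : flat R) : Prop :=
  [/\ [/\ is_point P, is_point Q, is_point S & is_point U],
      noncollinear P Q S, noncollinear P Q U,
      noncollinear P S U & noncollinear Q S U].

(* Convergence in the space of d-dimensional subspaces (its topology being the
   quotient of that of the space of d-frames): V(t) tends to W along F when
   some bases of the V(t) tend to a basis of W.  In particular it forces
   \dim W = d, and \dim V(t) = d for t near the limit. *)
Definition subspace_cvg (R : realType) (d : nat) (F : set_system R)
    (V : R -> flat R) (W : flat R) : Prop :=
  exists (e : R -> 'I_d -> 'rV[R]_3) (e0 : 'I_d -> 'rV[R]_3),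
    [/\ \forall t \near F, basis_of (V t) [seq e t i | i <- enum 'I_d],
        basis_of W [seq e0 i | i <- enum 'I_d]
      & forall i, e t i @[t --> F] --> e0 i].

(* The decoration of the point gamma 0 induced by gamma is the line l. *)
Definition point_decoration (R : realType) (gamma : R -> flat R)
    (l : flat R) : Prop :=
  subspace_cvg 2 (0^') (fun t => (gamma 0%R + gamma t)%VS) l.

(* The decoration of the line gamma 0 induced by gamma is the point P. *)
Definition line_decoration (R : realType) (gamma : R -> flat R)
    (P : flat R) : Prop :=
  subspace_cvg 1 (0^') (fun t => (gamma 0%R :&: gamma t)%VS) P.

(* Smoothness at t0 of a curve of points: it has a C^oo lift to R^3 minus 0. *)
Definition smooth_point_curve_at (R : realType) (gamma : R -> flat R)
    (t0 : R) : Prop :=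
  exists u : R -> 'rV[R]_3,
    \forall t \near t0,
      [/\ gamma t = <[u t]>%VS, u t != 0 &
          forall (j : 'I_3) (m : nat),
            derivable (derive1n m (fun s => u s ord0 j)) t 1].

(* The index sets Z and 1/2 + Z are told apart by a boolean: for h = false
   the integer k stands for the index k, for h = true it stands for k + 1/2.
   The opposite set belongs to ~~ h, and up_half h k, down_half h k represent
   in ~~ h the indices i + 1/2 and i - 1/2, where i is represented by k in h. *)
Definition up_half (h : bool) (k : int) : int := if h then k + 1 else k.
Definition down_half (h : bool) (k : int) : int := if h then k else k - 1.

Definition polygon (R : realType) (h : bool) := int -> flat R.

Definition twisted (R : realType) (h : bool) (n : nat)
    (A : polygon R h) : Prop :=
  (exists phi : 'End('rV[R]_3),
     lker phi = 0%VS /\ forall k, A (k + n%:Z) = (phi @: A k)%VS) /\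
  (forall k, general_position (A k) (A (k + 1)) (A (k + 2)) (A (k + 3))).

(* Indexed by ~~ h. *)
Definition side (R : realType) (h : bool) (A : polygon R h) (k : int) :
    flat R :=
  addv (A (down_half (~~ h) k)) (A (up_half (~~ h) k)).

(* The line b_i, indexed by h like A. *)
Definition short_diagonal (R : realType) (h : bool) (A : polygon R h)
    (k : int) : flat R :=
  addv (A (k - 1)) (A (k + 1)).

Definition pentagram (R : realType) (h : bool) (A : polygon R h) :
    polygon R (~~ h) :=
  fun k => capv (short_diagonal A (down_half (~~ h) k))
                (short_diagonal A (up_half (~~ h) k)).

(* A (germ at 0 of a) smooth curve in the space of twisted n-gons.  The
   transformations phi_t are determined by four consecutive vertices and their
   images, so they vary smoothly with t when the vertices do. *)
Definition twisted_curve (R : realType) (h : bool) (n : nat)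
    (A : R -> polygon R h) : Prop :=
  \forall t \near (0 : R),
    twisted n (A t) /\ forall k, smooth_point_curve_at (fun s => A s k) t.

Record decorated (R : realType) (h : bool) := Decorated {
  vertex : polygon R h;
  vertex_deco : int -> flat R;  (* lines, indexed by h *)
  side_deco : int -> flat R     (* points, indexed by ~~ h *)
}.

(* D is the decorated polygon induced by the curve A of twisted n-gons. *)
Definition induces (R : realType) (h : bool) (n : nat)
    (A : R -> polygon R h) (D : decorated R h) : Prop :=
  [/\ twisted_curve n A,
      vertex D = A 0,
      forall k, point_decoration (fun t => A t k) (vertex_deco D k)
    & forall k, line_decoration (fun t => side (A t) k) (side_deco D k)].

(* No decoration of a vertex is a side through that vertex, and no decoration
   of a side is an endpoint of that side.  The decorations then fix, to leading
   order, the ratio of the displacements of any two vertices.  In general they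
   do not, and then do not determine the decorations of the image either: for
   a pentagon A_1 ... A_5 (phi_t = id) whose vertices A_1 and A_3 move along
   a_{3/2} and a_{7/2}, doubling the speeds of A_2 and A_3 alone leaves all
   decorations of A unchanged, but in general not that of b_2. *)
Definition transverse (R : realType) (h : bool) (D : decorated R h) : Prop :=
  (forall k, vertex_deco D k <> side (vertex D) (down_half h k) /\
             vertex_deco D k <> side (vertex D) (up_half h k)) /\
  (forall k, side_deco D k <> vertex D (down_half (~~ h) k) /\
             side_deco D k <> vertex D (up_half (~~ h) k)).

(* No side b_i of the pentagram image has the two vertices A_{i-1}, A_{i+1}
   spanning it both moving along it, and no vertex B_j has the two lines
   b_{j-1/2}, b_{j+1/2} meeting there both turning about it.  Otherwise b_i
   (resp. B_j) is stationary to leading order, and its decoration depends on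
   higher-order terms of the curve that the decorations of A do not see. *)
Definition nonstationary (R : realType) (h : bool) (DA : decorated R h)
    (DB : decorated R (~~ h)) : Prop :=
  (forall k, ~ (vertex_deco DA (k - 1) = short_diagonal (vertex DA) k /\
                vertex_deco DA (k + 1) = short_diagonal (vertex DA) k)) /\
  (forall k, ~ (side_deco DB (down_half (~~ h) k) = vertex DB k /\
                side_deco DB (up_half (~~ h) k) = vertex DB k)).

(* Main.v *)
Require Import Defs.
From mathcomp Require Import all_boot all_order all_algebra.
From mathcomp Require Import all_classical all_reals all_analysis.
From mathcomp Require Import ring.
Import Order.TTheory GRing.Theory Num.Theory.
Import numFieldNormedType.Exports.

(** The decorations of A record, to leading order, the motion of all its
vertices up to one common scalar function of time, and the leading motion of B
is a function of this information.

Lift the vertices to vectors of R^3. If [u] spans a vertex and [u, v] span its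
decoration, the moving vertex has a lift u + s(t) (v + o(1)) for some nonvanishing
scalar function s, its speed ([point_decoration_first_order]). No power of t is
singled out: the speed may vanish at 0 to any order, and the speeds of
different vertices are only comparable because of the sides. Indeed the point
where a side meets its displaced copy divides the two endpoints according to
how far each has moved, so the decoration of a side gives the limit of the
quotient of the speeds of its endpoints ([line_decoration_ratio]). This limit
is finite and nonzero by transversality. Going along the polygon, one scale s(t)
serves all vertices, with velocities that depend only on the decorations
([common_scale]).

Lines are represented by their normals, and the join of two points as well as
the meet of two lines is a cross product. The product rule then gives the
velocity [M'] of the normal [M] of each short diagonal b_i, and next the
velocity [b'] of each vertex [b] of the image. Incidence with a moving line is
the vanishing of a dot product, which passes to the limit and can be divided by
s(t). So the decoration of b_i is orthogonal to [M] and [M'], and that of the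
vertex is orthogonal to [cross b b'] ([side_deco_pentagram],
[vertex_deco_pentagram]). Nonstationarity says that these pairs are
independent ([cross_velocity_eq0]), hence the decorations are determined. *)

Set Implicit Arguments.
Unset Strict Implicit.
Unset Printing Implicit Defensive.

Local Open Scope classical_set_scope.
Local Open Scope ring_scope.

(** * Cross products in R^3 *)

Section Vectors.
Context {R : realType}.
Implicit Types u v w x y m n : 'rV[R]_3.

Definition dot u v : R := \sum_i u 0 i * v 0 i.

(** Indices are taken in Z/3, which makes the formula uniform in [i]. *)
Definition cross u v : 'rV[R]_3 :=
  \row_i (u 0 (i + 1) * v 0 (i + 2%:R) - u 0 (i + 2%:R) * v 0 (i + 1)).

Lemma dotE u v : dot u v = u 0 0 * v 0 0 + u 0 1 * v 0 1 + u 0 2%:R * v 0 2%:R.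
Proof.
rewrite /dot !big_ord_recl big_ord0 addr0 addrA.
by congr (_ * _ + _ * _ + _ * _); congr (_ _ _); apply/val_inj.
Qed.

Lemma crossE u v :
  (cross u v 0 0 = u 0 1 * v 0 2%:R - u 0 2%:R * v 0 1) *
  (cross u v 0 1 = u 0 2%:R * v 0 0 - u 0 0 * v 0 2%:R) *
  (cross u v 0 2%:R = u 0 0 * v 0 1 - u 0 1 * v 0 0).
Proof.
by split; [split|]; rewrite mxE; congr (_ * _ - _ * _); congr (_ _ _);
  apply/val_inj.
Qed.

Lemma vectorP u v :
  u 0 0 = v 0 0 -> u 0 1 = v 0 1 -> u 0 2%:R = v 0 2%:R -> u = v.
Proof.
move=> e0 e1 e2; apply/rowP => -[[|[|[|//]]] i].
- by rewrite (_ : Ordinal i = 0) //; apply/val_inj.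
- by rewrite (_ : Ordinal i = 1) //; apply/val_inj.
- by rewrite (_ : Ordinal i = 2%:R) //; apply/val_inj.
Qed.

End Vectors.

Ltac vector_ring :=
  first [apply: vectorP | idtac]; rewrite ?(dotE, crossE, mxE); ring.

Section VectorIdentities.
Context {R : realType}.
Implicit Types u v w x y m n : 'rV[R]_3.

Lemma dotC u v : dot u v = dot v u.
Proof. vector_ring. Qed.

Lemma dotDl u v w : dot (u + v) w = dot u w + dot v w.
Proof. vector_ring. Qed.

Lemma dotZl a u v : dot (a *: u) v = a * dot u v.
Proof. vector_ring. Qed.

Lemma dotDr w u v : dot w (u + v) = dot w u + dot w v.
Proof. vector_ring. Qed.

Lemma dotBr w u v : dot w (u - v) = dot w u - dot w v.
Proof. vector_ring. Qed.

Lemma dotZr a u v : dot u (a *: v) = a * dot u v.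
Proof. vector_ring. Qed.

Lemma crossZl a u v : cross (a *: u) v = a *: cross u v.
Proof. vector_ring. Qed.

Lemma crossZr a u v : cross u (a *: v) = a *: cross u v.
Proof. vector_ring. Qed.

Lemma crossvv u : cross u u = 0.
Proof. vector_ring. Qed.

Lemma dot_cross_l u v : dot u (cross u v) = 0.
Proof. vector_ring. Qed.

Lemma dot_cross_r u v : dot v (cross u v) = 0.
Proof. vector_ring. Qed.

Lemma cross_cross x u v : cross x (cross u v) = dot x v *: u - dot x u *: v.
Proof. vector_ring. Qed.

Lemma cross_crossl u v w : cross (cross u v) w = dot w u *: v - dot w v *: u.
Proof. vector_ring. Qed.

Lemma crossB u v u0 v0 :
  cross u v - cross u0 v0 = cross (u - u0) v + cross u0 (v - v0).
Proof. vector_ring. Qed.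

(** Cramer's rule in the basis [u, v, cross u v]. *)
Lemma cross_expansion u v x (n := cross u v) :
  dot n n *: x = dot (cross x v) n *: u + dot (cross u x) n *: v + dot x n *: n.
Proof. rewrite /n; vector_ring. Qed.

Lemma dotvv_eq0 u : (dot u u == 0) = (u == 0).
Proof.
rewrite dotE; apply/eqP/eqP => [e|->]; last by rewrite !mxE !mulr0 !addr0.
have sq a : 0 <= a * a :> R by rewrite -expr2 sqr_ge0.
move/eqP: e; rewrite !paddr_eq0 ?addr_ge0 // !mulf_eq0 !orbb.
by case/andP => /andP[/eqP e0 /eqP e1] /eqP e2; apply: vectorP; rewrite !mxE.
Qed.

(** Parallelism of [cross x y] and [m], with the coefficient cleared of its
denominator. *)
Lemma cross_ortho x y m : m != 0 -> dot x m = 0 -> dot y m = 0 ->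
  dot m m *: cross x y = dot (cross x y) m *: m.
Proof.
move=> m0 xm ym.
have -> : dot m m *: cross x y = dot (cross x y) m *: m
   + dot x m *: cross m y  - dot y m *: cross m x by vector_ring.
by rewrite xm ym !scale0r addr0 subr0.
Qed.

End VectorIdentities.

(** * Lines and planes of R^3 through their normals *)

Section Flats.
Context {R : realType}.
Implicit Types (u v w x y m n : 'rV[R]_3) (U V W : flat R).

Lemma cross_ortho_neq0 x y m : m != 0 -> cross x y != 0 ->
  dot x m = 0 -> dot y m = 0 -> dot (cross x y) m != 0.
Proof.
move=> m0 xy0 xm ym; have E := cross_ortho m0 xm ym.
apply: contra_neq xy0 => z; apply/eqP; move/eqP: E.
by rewrite z scale0r scaler_eq0 dotvv_eq0 (negPf m0).
Qed.

Lemma vline_cross x u : x \in <[u]>%VS -> cross x u = 0.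
Proof. by move=> /vlineP[a ->]; rewrite crossZl crossvv scaler0. Qed.

Lemma cross0_vline x u : u != 0 -> cross x u = 0 -> x \in <[u]>%VS.
Proof.
move=> u0 xu0; apply/vlineP; exists (dot x u / dot u u).
have uu : dot u u != 0 by rewrite dotvv_eq0.
apply: (scalerI uu); rewrite scalerA mulrCA divff // mulr1.
have E := cross_cross u x u.
rewrite xu0 [dot u x]dotC in E.
by apply/eqP; rewrite -subr_eq0 -E; apply/eqP; vector_ring.
Qed.

Lemma vline_eq u a : a != 0 -> <[a *: u]>%VS = <[u]>%VS :> flat R.
Proof.
move=> a0; apply/eqP; rewrite eqEsubv -!memvE; apply/andP; split.
  by rewrite memvZ // memv_line.
by rewrite -[X in X \in _](scalerK a0) memvZ // memv_line.
Qed.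

Lemma dim1_vpick U : \dim U = 1%N -> U = <[vpick U]>%VS /\ vpick U != 0.
Proof.
move=> dU.
have nz : vpick U != 0 by rewrite vpick0 -dimv_eq0 dU.
split=> //; apply/esym/eqP.
by rewrite eqEdim -memvE memv_pick dU dim_vline nz.
Qed.

Lemma span2_normal u v x : x \in (<[u]> + <[v]>)%VS -> dot x (cross u v) = 0.
Proof.
case/memv_addP => _ /vlineP[a ->] [_ /vlineP[b ->] ->].
by rewrite dotDl !dotZl dot_cross_l dot_cross_r !mulr0 addr0.
Qed.

Lemma normal_span2 u v x : cross u v != 0 -> dot x (cross u v) = 0 ->
  x \in (<[u]> + <[v]>)%VS.
Proof.
rewrite -dotvv_eq0 => n0 xn; have /= E := cross_expansion u v x.
rewrite xn scale0r addr0 in E.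
rewrite -[x](scalerK n0) E memvZ // memv_add // memvZ // memv_line //.
Qed.

Lemma dim_span2 u v : (\dim (<[u]> + <[v]> : flat R)%VS == 2%N) = (cross u v != 0).
Proof.
apply/eqP/idP => [d2|n0].
  apply/eqP => c0; have [u0|u0] := eqVneq u 0.
    by move: d2; rewrite u0 add0v dim_vline; case: (v == 0).
  have : v \in <[u]>%VS.
    by apply: cross0_vline => //; rewrite -[RHS]oppr0 -c0; vector_ring.
  rewrite memvE => /addv_idPl E.
  by move: d2; rewrite E dim_vline u0.
have u0 : u != 0 by apply: contraNneq n0 => ->; apply/eqP; vector_ring.
have v0 : v != 0 by apply: contraNneq n0 => ->; apply/eqP; vector_ring.
rewrite dimv_disjoint_sum ?dim_vline ?u0 ?v0 //.
apply/eqP; rewrite -subv0; apply/subvP => x; rewrite memv_cap memv0.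
case/andP => /vlineP[a ->] /vline_cross; rewrite crossZl => /eqP.
by rewrite scaler_eq0 (negPf n0) orbF => /eqP ->; rewrite scale0r.
Qed.

Lemma dim2_span2 U u : \dim U = 2%N -> u \in U -> u != 0 ->
  let v := vpick (U :\: <[u]>) in U = (<[u]> + <[v]>)%VS /\ cross u v != 0.
Proof.
move=> dU uU u0 v.
have E : (<[u]> <= U)%VS by rewrite -memvE.
have d1 : \dim (U :\: <[u]>) = 1%N.
  apply/eqP; rewrite -(eqn_add2l (\dim (U :&: <[u]>))) dimv_cap_compl dU.
  by rewrite (capv_idPr E) dim_vline u0.
have UE : U = (<[u]> + <[v]>)%VS.
  by rewrite /v -(proj1 (dim1_vpick d1)) addvC addv_diff; apply/esym/addv_idPl.
by split=> //; rewrite -dim_span2 -UE dU.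
Qed.

(** Decorations of points are compared through this lemma: they are planes of
R^3, and the normals found for the two of them coincide. *)
Lemma plane_normal_inj U V n : n != 0 -> \dim U = 2%N -> \dim V = 2%N ->
  (forall x, x \in U -> dot x n = 0) -> (forall x, x \in V -> dot x n = 0) ->
  U = V.
Proof.
move=> n0 dU dV Un Vn; apply/esym/eqP; rewrite eqEdim dU dV andbT.
have := @dim2_span2 U (vpick U) dU (memv_pick U).
rewrite vpick0 -dimv_eq0 dU => /(_ isT) /=; set u := vpick U; set v := vpick _.
case=> UE uv0; apply/subvP => x xV; rewrite UE; apply: normal_span2 => //.
have uU : u \in U by exact: memv_pick.
have vU : v \in U by rewrite UE (subvP (addvSr _ _)) ?memv_line.
have nn : dot n n != 0 by rewrite dotvv_eq0.
apply: (mulfI nn); rewrite mulr0 -dotZr (cross_ortho n0 (Un _ uU) (Un _ vU)).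
by rewrite dotZr (Vn _ xV) mulr0.
Qed.

(** The dual tool, for decorations of lines and for the vertices of the
image. *)
Lemma line_normals_eq U m n : cross m n != 0 -> \dim U = 1%N ->
  (forall x, x \in U -> dot x m = 0 /\ dot x n = 0) -> U = <[cross m n]>%VS.
Proof.
move=> mn0 dU Umn; apply/eqP; rewrite eqEdim dim_vline mn0 dU andbT.
apply/subvP => x /Umn[xm xn]; apply: cross0_vline => //.
by rewrite cross_cross xm xn !scale0r subr0.
Qed.

End Flats.

(** * Limits of subspaces *)

Section Limits.
Context {R : realType} (F : set_system R) {FF : ProperFilter F}.
Implicit Types (f g : R -> 'rV[R]_3) (u v w x m n : 'rV[R]_3) (V : R -> flat R).

Lemma cvg_rowP f u :
  f @ F --> u <-> forall i, f t 0 i @[t --> F] --> u 0 i.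
Proof.
split=> [fu i|fu].
  exact: (cvg_comp _ _ fu (@coord_continuous R 1 3 0 i u)).
have E (w : 'rV[R]_3) : w = \sum_i w 0 i *: delta_mx 0 i by exact: row_sum_delta.
rewrite (E u) (_ : f = fun t => \sum_i f t 0 i *: delta_mx 0 i); last first.
  by apply/funext => t; exact: E.
apply: (cvg_big (@add_continuous _)) => i _; exact: cvgZr_tmp.
Qed.

Lemma cvg_dot f g u v : f @ F --> u -> g @ F --> v ->
  dot (f t) (g t) @[t --> F] --> dot u v.
Proof.
move=> /cvg_rowP fu /cvg_rowP gv; apply: (cvg_big (@add_continuous _)) => i _.
exact: (cvgM (fu i) (gv i)).
Qed.

Lemma cvg_cross f g u v : f @ F --> u -> g @ F --> v ->
  cross (f t) (g t) @[t --> F] --> cross u v.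
Proof.
move=> /cvg_rowP fu /cvg_rowP gv; apply/cvg_rowP => i.
under eq_fun do rewrite mxE; rewrite mxE.
by apply: cvgB; exact: cvgM.
Qed.

Lemma frame_mem d (W : flat R) (e : 'I_d -> 'rV[R]_3) i :
  basis_of W [seq e i | i <- enum 'I_d] -> e i \in W.
Proof. by move=> /basis_mem; apply; rewrite map_f ?mem_enum. Qed.

(** Orthogonality is a closed condition, so it passes to limits of subspaces. *)
Lemma subspace_cvg_ortho d V W f w : subspace_cvg d F V W -> f @ F --> w ->
  (\forall t \near F, forall x, x \in V t -> dot x (f t) = 0) ->
  forall x, x \in W -> dot x w = 0.
Proof.
case=> e [e0 [be be0 ce]] fw Vf.
have e0w i : dot (e0 i) w = 0.
  apply: (@cvg_unique _ (@norm_hausdorff _ _) (fmap (fun t => dot (e t i) (f t)) F)).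
    by apply: cvg_dot.
  apply: cvg_near_cst; near=> t; apply: (near Vf t) => //.
  by apply: frame_mem; near: t.
move=> x; rewrite -(span_basis be0) => /coord_span ->.
elim/big_ind: _ => [|y z yw zw|i _]; first by rewrite dotE !mxE !mul0r !addr0.
  by rewrite dotDl yw zw addr0.
have /mapP[j _ ->] : [seq e0 j | j <- enum 'I_d]`_i \in [seq e0 j | j <- enum 'I_d].
  by rewrite mem_nth // size_map -cardE.
by rewrite dotZl e0w mulr0.
Unshelve. all: end_near. Qed.

Lemma frame2_span (W : flat R) (e : 'I_2 -> 'rV[R]_3) :
  basis_of W [seq e i | i <- enum 'I_2] -> W = (<[e 0%R]> + <[e 1%R]>)%VS.
Proof.
move=> be; rewrite -(span_basis be) !enum_ordSl enum_ord0 /= span_cons span_seq1.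
by congr (<[e _]> + <[e _]>)%VS; apply/val_inj.
Qed.

Lemma frame1_span (W : flat R) (e : 'I_1 -> 'rV[R]_3) :
  basis_of W [seq e i | i <- enum 'I_1] -> W = <[e 0%R]>%VS.
Proof.
move=> be; rewrite -(span_basis be) !enum_ordSl enum_ord0 /= span_seq1.
by congr (<[e _]>)%VS; apply/val_inj.
Qed.

Lemma subspace_cvg_dim d V (W : flat R) : subspace_cvg d F V W ->
  \dim W = d /\ \forall t \near F, \dim (V t) = d.
Proof.
case=> e [e0 [be be0 _]]; split.
  by rewrite -(span_basis be0) (eqnP (basis_free be0)) size_map size_enum_ord.
near=> t; have bt : basis_of (V t) [seq e t i | i <- enum 'I_d] by near: t.
by rewrite -(span_basis bt) (eqnP (basis_free bt)) size_map size_enum_ord.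
Unshelve. all: end_near. Qed.

(** Normalised by its product with the limiting normal [n], a normal of
[V t] does not depend on its choice, and the cross product of a convergent
frame of [V t] is one choice for which convergence is clear. *)
Lemma subspace_cvg_normal V (W : flat R) f n : subspace_cvg 2 F V W ->
  n != 0 -> (forall x, x \in W -> dot x n = 0) ->
  (\forall t \near F, f t != 0 /\ forall x, x \in V t -> dot x (f t) = 0) ->
  (\forall t \near F, dot (f t) n != 0) /\
  (dot (f t) n)^-1 *: f t @[t --> F] --> (dot n n)^-1 *: n.
Proof.
case=> e [e0 [be be0 ce]] n0 Wn Vf.
have dimE (X : flat R) (g : 'I_2 -> 'rV[R]_3) :
    basis_of X [seq g i | i <- enum 'I_2] ->
    cross (g 0) (g 1) != 0.
  move=> bX; rewrite -dim_span2 -(frame2_span bX) -(span_basis bX).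
  by rewrite (eqnP (basis_free bX)) size_map size_enum_ord.
pose N t := cross (e t 0) (e t 1); pose N0 := cross (e0 0) (e0 1).
have NN0 : N t @[t --> F] --> N0 by apply: cvg_cross.
have [e0n0 e0n1] : dot (e0 0) n = 0 /\ dot (e0 1) n = 0.
  by split; apply: Wn; apply: frame_mem.
have N0n : dot N0 n != 0 by apply: cross_ortho_neq0 => //; exact: dimE be0.
have Nn : dot (N t) n @[t --> F] --> dot N0 n by apply: cvg_dot => //; exact: cvg_cst.
have fN : \forall t \near F, [/\ dot (f t) n != 0, dot (N t) n != 0
    & (dot (f t) n)^-1 *: f t = (dot (N t) n)^-1 *: N t].
  near=> t.
  have Nt0 : dot (N t) n != 0 by near: t; apply: (cvgr_neq0 _ Nn).
  have bt : basis_of (V t) [seq e t i | i <- enum 'I_2] by near: t.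
  have [ft0 Vt] : f t != 0 /\ forall x, x \in V t -> dot x (f t) = 0 by near: t.
  have e0t : dot (e t 0) (f t) = 0 by apply: Vt; exact: frame_mem.
  have e1t : dot (e t 1) (f t) = 0 by apply: Vt; exact: frame_mem.
  have Nf0 : dot (N t) (f t) != 0 by apply: cross_ortho_neq0 => //; exact: dimE bt.
  have ff0 : dot (f t) (f t) != 0 by rewrite dotvv_eq0.
  have E : f t = (dot (f t) (f t) / dot (N t) (f t)) *: N t.
    apply: (scalerI Nf0); rewrite -(cross_ortho ft0 e0t e1t) scalerA.
    by rewrite mulrCA divff ?mulr1.
  move: E; set a := _ / _ => E.
  have a0 : a != 0 by rewrite mulf_neq0 ?invr_eq0.
  rewrite E dotZl mulf_neq0 //; split=> //.
  by rewrite invfM scalerA mulrAC mulVf // mul1r.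
split; first by apply: filterS fN => t [].
have -> : (dot n n)^-1 *: n = (dot N0 n)^-1 *: N0.
  have nn : dot n n != 0 by rewrite dotvv_eq0.
  apply: (scalerI nn); apply: (scalerI N0n); rewrite scalerKV // !scalerA.
  by rewrite mulrAC divff // mul1r (cross_ortho n0 e0n0 e0n1).
apply: cvg_trans (cvgZ (cvgV N0n Nn) NN0).
apply: near_eq_cvg; near=> t.
by have [] : [/\ dot (f t) n != 0, dot (N t) n != 0
    & (dot (f t) n)^-1 *: f t = (dot (N t) n)^-1 *: N t] by near: t.
Unshelve. all: end_near. Qed.

End Limits.

(** * Velocities relative to a scale *)

Section FirstOrder.
Context {R : realType} (F : set_system R) {FF : ProperFilter F}.
Implicit Types (s : R -> R) (f g : R -> 'rV[R]_3) (u v w x m n : 'rV[R]_3).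

(** [f] has velocity [v] at [u] when time is measured by [s]; for [s] the
identity this is a derivative. A general [s] is needed since curves may stop
at 0, to any order or even flatly. *)
Definition first_order s f u v :=
  f @ F --> u /\ (s t)^-1 *: (f t - u) @[t --> F] --> v.

Lemma first_order_cross s f g u v u' v' :
  first_order s f u v -> first_order s g u' v' ->
  first_order s (fun t => cross (f t) (g t)) (cross u u')
    (cross v u' + cross u v').
Proof.
move=> [fu fv] [gu gv]; split; first exact: cvg_cross.
under eq_fun do rewrite crossB scalerDr -crossZl -crossZr.
by apply: cvgD; apply: cvg_cross => //; exact: cvg_cst.
Qed.

Lemma first_order_rescale s s' (r : R) f u v : first_order s' f u v ->
  (\forall t \near F, s' t != 0) -> s' t / s t @[t --> F] --> r ->
  first_order s f u (r *: v).
Proof.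
move=> [fu fv] s'0 sr; split=> //.
apply: cvg_trans (cvgZ sr fv); apply: near_eq_cvg; near=> t.
by rewrite scalerA mulrAC divff ?mul1r //; near: t.
Unshelve. all: end_near. Qed.

(** An incidence that holds with the moving normal and with the initial one
holds with their difference quotient, so with the velocity in the limit. *)
Lemma first_order_ortho d V (W : flat R) s f u v :
  subspace_cvg d F V W -> first_order s f u v ->
  (\forall t \near F, forall x, x \in V t -> dot x u = 0 /\ dot x (f t) = 0) ->
  forall x, x \in W -> dot x u = 0 /\ dot x v = 0.
Proof.
move=> VW [fu fv] Vf x xW; split.
  apply: subspace_cvg_ortho VW (cvg_cst u) _ _ xW.
  by apply: filterS Vf => t Vt y /Vt[].
apply: subspace_cvg_ortho VW fv _ _ xW.
by apply: filterS Vf => t Vt y /Vt[yu yf]; rewrite dotZr dotBr yu yf subrr mulr0.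
Qed.

(** The velocity of [n] is parallel to [n] only if both points [u] and [u'] move
inside the line that they span: [cross n] maps that velocity to
[dot v' n *: u - dot v n *: u'], where [u] and [u'] are independent. Applied to
points it concerns a short diagonal, applied to normals a vertex of the
image. *)
Lemma cross_velocity_eq0 u v u' v' (n := cross u u') : n != 0 ->
  cross n (cross v u' + cross u v') = 0 -> dot v n = 0 /\ dot v' n = 0.
Proof.
move=> n0.
have -> : cross n (cross v u' + cross u v') = dot v' n *: u - dot v n *: u'.
  by rewrite /n; vector_ring.
move=> E.
have /eqP : cross (dot v' n *: u - dot v n *: u') u' = 0.
  by rewrite E; vector_ring.
have -> : cross (dot v' n *: u - dot v n *: u') u' = dot v' n *: n.
  by rewrite /n; move: (dot _ _) (dot _ _) => *; vector_ring.
have /eqP : cross u (dot v' n *: u - dot v n *: u') = 0.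
  by rewrite E; vector_ring.
have -> : cross u (dot v' n *: u - dot v n *: u') = - dot v n *: n.
  by rewrite /n; move: (dot _ _) (dot _ _) => *; vector_ring.
by rewrite !scaler_eq0 oppr_eq0 !(negPf n0) !orbF => /eqP ? /eqP ?.
Qed.

End FirstOrder.

(** * What the decorations of a point and of a line tell *)

Section Vertex.
Context {R : realType}.
Implicit Types (s : R -> R) (f g : R -> 'rV[R]_3) (u v w x m n : 'rV[R]_3)
  (gamma : R -> flat R).

Lemma smooth_point_curve_lift gamma : smooth_point_curve_at gamma 0 ->
  exists g, [/\ gamma 0 = <[g 0%R]>%VS, g 0 != 0, g t @[t --> 0^'] --> g 0
    & \forall t \near 0^', gamma t = <[g t]>%VS].
Proof.
case=> g gP; exists g; have [g0 gn0 gd] := nbhs_singleton gP; split=> //.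
  apply/cvg_rowP => i; apply/continuous_withinNx.
  by apply/differentiable_continuous/derivable1_diffP; exact: (gd i 0%N).
by apply: cvg_within; apply: filterS gP => t [].
Qed.

(** A decoration gives a velocity: the lift [f] is normalised by the linear form
[dot (cross v n)], which vanishes on [v] and not on [u], so that [f t - u] is
recovered linearly from the normal [cross u (f t)] of the line joining the two
positions. The speed [s] is the size of that normal along its limit [n]. *)
Lemma point_decoration_first_order gamma u v :
  smooth_point_curve_at gamma 0 -> gamma 0 = <[u]>%VS ->
  point_decoration gamma (<[u]> + <[v]>)%VS -> cross u v != 0 ->
  exists sf : (R -> R) * (R -> 'rV[R]_3),
    [/\ \forall t \near 0^', sf.1 t != 0,
        \forall t \near 0^', gamma t = <[sf.2 t]>%VS
      & first_order 0^' sf.1 sf.2 u v].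
Proof.
move=> /smooth_point_curve_lift[g [g0 gn0 gcvg gg]] gu deco.
set n := cross u v => n0.
have nn0 : dot n n != 0 by rewrite dotvv_eq0.
pose l := cross v n; have lu : dot l u = dot n n by rewrite /l /n; vector_ring.
have [a ga] : exists a, g 0 = a *: u.
  by apply/vlineP; rewrite -gu g0 memv_line.
have a0 : a != 0 by apply: contraNneq gn0 => z; rewrite ga z scale0r.
have lgcvg : dot l (g t) @[t --> 0^'] --> a * dot n n.
  by rewrite -lu -dotZr -ga; apply: cvg_dot => //; exact: cvg_cst.
have lg0 : \forall t \near 0^', dot l (g t) != 0.
  by apply: (cvgr_neq0 _ lgcvg); rewrite mulf_neq0.
pose f t := (dot n n / dot l (g t)) *: g t.
have fu : f t @[t --> 0^'] --> u.
  have -> : u = (dot n n / (a * dot n n)) *: g 0.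
    by rewrite ga scalerA invfM mulrCA divff // mulr1 mulVf // scale1r.
  apply: (cvgZ _ gcvg); apply: cvgM; first exact: cvg_cst.
  by apply: cvgV; rewrite ?mulf_neq0.
have lf : \forall t \near 0^', dot l (f t) = dot n n.
  by near=> t; rewrite /f dotZr -mulrA mulVf ?mulr1 //; near: t.
have gf : \forall t \near 0^', gamma t = <[f t]>%VS.
  near=> t; rewrite /f vline_eq; first by near: t.
  by rewrite mulf_neq0 ?invr_eq0 //; near: t.
have [_ dimV] := subspace_cvg_dim deco.
have [w0 wn] : (\forall t \near 0^', dot (cross u (f t)) n != 0) /\
    (dot (cross u (f t)) n)^-1 *: cross u (f t) @[t --> 0^'] --> (dot n n)^-1 *: n.
  apply: (subspace_cvg_normal deco) => //; first by move=> x /span2_normal.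
  near=> t.
  have Et : gamma t = <[f t]>%VS by near: t.
  split; last by move=> x; rewrite gu Et => /span2_normal.
  by rewrite -dim_span2 -gu -Et; apply/eqP; near: t.
exists (fun t => dot (cross u (f t)) n / dot n n, f) => /=; split=> //.
  by near=> t; rewrite mulf_neq0 ?invr_eq0 //; near: t.
split=> //.
have -> : v = cross ((dot n n)^-1 *: n) l.
  apply: (scalerI nn0); rewrite -crossZl scalerKV //.
  by rewrite /l /n; vector_ring.
apply: cvg_trans (cvg_cross wn (cvg_cst l)); apply: near_eq_cvg; near=> t.
rewrite crossZl invfM invrK mulrC -scalerA.
have lft : dot l (f t) = dot n n by near: t.
by rewrite cross_crossl lft lu -scalerBr !scalerA [X in X *: _]mulrC.
Unshelve. all: end_near. Qed.

Lemma triple_neq0 w x y m : m != 0 -> cross x y != 0 ->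
  dot x m = 0 -> dot y m = 0 -> dot w m != 0 -> dot w (cross x y) != 0.
Proof.
move=> m0 xy0 xm ym wm; have xym := cross_ortho_neq0 m0 xy0 xm ym.
have E := cross_ortho m0 xm ym; apply/eqP => z.
have := congr1 (dot w) E; rewrite !dotZr z mulr0 => /eqP.
by rewrite eq_sym mulf_eq0 (negPf xym) (negPf wm).
Qed.

(** The point where the line [u u'] meets the moved line divides the two
endpoints in the ratio of the distances that they moved away from the line,
weighted by the directions of motion. Knowing that point in the limit thus
gives the ratio of the speeds. *)
Lemma line_decoration_ratio gamma gamma' s s' f f' u v u' v' e
    (m := cross u u') :
  gamma 0 = <[u]>%VS -> gamma' 0 = <[u']>%VS ->
  (\forall t \near 0^', gamma t = <[f t]>%VS) ->
  (\forall t \near 0^', gamma' t = <[f' t]>%VS) ->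
  (\forall t \near 0^', s t != 0) -> (\forall t \near 0^', s' t != 0) ->
  first_order 0^' s f u v -> first_order 0^' s' f' u' v' ->
  line_decoration (fun t => gamma t + gamma' t)%VS <[e]>%VS ->
  m != 0 -> dot v m != 0 -> dot v' m != 0 -> cross e u != 0 -> cross e u' != 0 ->
  s' t / s t @[t --> 0^'] --> - (dot e (cross v u') / dot e (cross u v')) /\
  - (dot e (cross v u') / dot e (cross u v')) != 0.
Proof.
move=> gu gu' gf gf' s0 s'0 [fu fv] [fu' fv'] deco m0 vm vm' eu eu'.
have em : dot e m = 0.
  apply: (subspace_cvg_ortho deco (cvg_cst m)); last exact: memv_line.
  by near=> t => x; rewrite memv_cap gu gu' => /andP[/span2_normal].
have a0 : dot e (cross v u') != 0.
  have -> : dot e (cross v u') = dot v (cross u' e) by vector_ring.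
  apply: triple_neq0 vm => //; last by rewrite /m dot_cross_r.
  by apply: contra_neq eu' => z; rewrite -[RHS]oppr0 -z; vector_ring.
have b0 : dot e (cross u v') != 0.
  have -> : dot e (cross u v') = dot v' (cross e u) by vector_ring.
  by apply: triple_neq0 vm' => //; rewrite /m dot_cross_l.
split; last by rewrite oppr_eq0 mulf_neq0 ?invr_eq0.
case: deco => eps [e0 [be be0 /(_ 0) ce]].
have [k ek] : exists k, e = k *: e0 0.
  by apply/vlineP; rewrite -(frame1_span be0) memv_line.
have k0 : k != 0 by apply: contraNneq a0 => z; rewrite ek z dotZl mul0r.
move: a0 b0; rewrite ek !dotZl !mulf_eq0 (negPf k0) /= => a0 b0.
rewrite -mulf_div divff // mul1r -mulNr.
have acvg : dot (eps t 0) (cross ((s t)^-1 *: (f t - u)) (f' t)) @[t --> 0^']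
    --> dot (e0 0) (cross v u').
  by apply: cvg_dot => //; apply: cvg_cross.
have bcvg : dot (eps t 0) (cross u ((s' t)^-1 *: (f' t - u'))) @[t --> 0^']
    --> dot (e0 0) (cross u v').
  by apply: cvg_dot => //; apply: cvg_cross => //; exact: cvg_cst.
apply: cvg_trans (cvgM (cvgN acvg) (cvgV b0 bcvg)); apply: near_eq_cvg.
near=> t.
have bt0 : dot (eps t 0) (cross u ((s' t)^-1 *: (f' t - u'))) != 0.
  by near: t; apply: (cvgr_neq0 _ bcvg).
have st0 : s t != 0 by near: t.
have st0' : s' t != 0 by near: t.
have : eps t 0 \in (gamma 0%R + gamma' 0%R)%VS /\
    eps t 0 \in (gamma t + gamma' t)%VS.
  by apply/andP; rewrite -memv_cap; apply: frame_mem; near: t.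
have -> : gamma t = <[f t]>%VS by near: t.
have -> : gamma' t = <[f' t]>%VS by near: t.
rewrite gu gu' => -[/span2_normal E0 /span2_normal Et].
(* [eps t 0] is orthogonal to the old and to the new normal of the line, hence
   to their difference, which [crossB] splits into the two displacements. *)
have E : s t * dot (eps t 0) (cross ((s t)^-1 *: (f t - u)) (f' t)) =
    - (s' t * dot (eps t 0) (cross u ((s' t)^-1 *: (f' t - u')))).
  rewrite crossZl crossZr !dotZr !mulVKf //; apply/eqP.
  by rewrite -addr_eq0 -dotDr -crossB dotBr E0 Et subrr.
apply: (mulIf bt0); apply: (mulfI st0) => /=.
rewrite -[in LHS]mulrA mulVf // mulr1 mulrN E opprK.
by rewrite mulrA mulrCA divff // mulr1.
Unshelve. all: end_near. Qed.

End Vertex.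

(** * A common scale for the vertices of a polygon *)

Section Indices.
Implicit Types (h : bool) (k : int).

Lemma down_up_half h k : down_half (~~ h) (up_half h k) = k.
Proof. by case: h; rewrite /= ?addrK. Qed.

Lemma up_up_half h k : up_half (~~ h) (up_half h k) = k + 1.
Proof. by case: h. Qed.

Lemma up_down_half h k : up_half (~~ h) (down_half h k) = k.
Proof. by case: h; rewrite /= ?subrK. Qed.

Lemma up_halfE h k : up_half h k = down_half h k + 1.
Proof. by case: h; rewrite /= ?subrK. Qed.

Lemma down_halfS h k : down_half h (k + 1) = up_half h k.
Proof. by case: h; rewrite /= ?addrK. Qed.

End Indices.

Section Polygons.
Context {R : realType} (h : bool) (n : nat).
Implicit Types (A : R -> polygon R h) (k : int).

(** A choice of homogeneous coordinates, made once for [D] and shared by all the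
curves that induce [D]. *)
Record coordinates (D : decorated R h) (u v e : int -> 'rV[R]_3) : Prop := {
  vertex_coord : forall k, vertex D k = <[u k]>%VS;
  vertex_deco_coord : forall k, vertex_deco D k = (<[u k]> + <[v k]>)%VS;
  side_deco_coord : forall k, side_deco D k = <[e k]>%VS;
  coord_motion : forall k, cross (u k) (v k) != 0;
  coord_side : forall k, cross (u k) (u (k + 1)) != 0;
  coord_diagonal : forall k, cross (u (k - 1)) (u (k + 1)) != 0;
  coord_side_deco : forall k, e k != 0
}.

Lemma noncollinear_cross (P Q S : 'rV[R]_3) :
  noncollinear <[P]>%VS <[Q]>%VS <[S]>%VS -> cross P Q != 0 /\ cross P S != 0.
Proof.
rewrite /noncollinear => d3.
have l1 (x : 'rV[R]_3) : (\dim <[x]>%VS <= 1)%N by rewrite dim_vline; case: (x == 0).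
have dS (U : flat R) x : (\dim (U + <[x]>)%VS <= (\dim U).+1)%N.
  apply: leq_trans (dimv_add_leqif _ _) _.
  by apply: leq_trans (leq_add (leqnn _) (l1 x)) _; rewrite addn1.
have d2 (x y : 'rV[R]_3) : (\dim (<[x]> + <[y]>)%VS <= 2)%N.
  by apply: leq_trans (dS _ _) _; rewrite ltnS.
have [dPQ dPS] := (dS (<[P]> + <[Q]>)%VS S, dS (<[P]> + <[S]>)%VS Q).
rewrite d3 ltnS in dPQ; rewrite -addvA [(<[S]> + _)%VS]addvC addvA d3 ltnS in dPS.
by rewrite -!dim_span2 !eqn_leq !d2 dPQ dPS.
Qed.

Lemma induces_at0 A D : induces n A D -> twisted n (A 0) /\
  forall k, smooth_point_curve_at (fun t => A t k) 0.
Proof. by case=> /nbhs_singleton. Qed.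

Lemma induces_coordinates A D : induces n A D ->
  exists u v e, coordinates D u v e.
Proof.
move=> AD; have [[_ gp] sm] := induces_at0 AD; case: AD => _ vD dv ds.
pose u k := vpick (vertex D k).
have uP k : vertex D k = <[u k]>%VS /\ u k != 0.
  by apply: dim1_vpick; rewrite vD; have [[]] := gp k.
(* A decoration passes through its vertex, as a limit of lines that do. *)
have udeco k : u k \in vertex_deco D k.
  have [d2 _] := subspace_cvg_dim (dv k).
  have [g [g0 gn0 gcvg gg]] := smooth_point_curve_lift (sm k).
  case: (dv k) => ep [e0 [be be0 ce]].
  rewrite (frame2_span be0); apply: normal_span2.
    by rewrite -dim_span2 -(frame2_span be0) d2.
  have : dot (u k) (cross (ep t 0) (ep t 1)) @[t --> 0^'] -->
      dot (u k) (cross (e0 0) (e0 1)).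
    by apply: cvg_dot; [exact: cvg_cst|exact: cvg_cross].
  move=> lim; apply: (@cvg_unique _ (@norm_hausdorff _ _) _ _ _ _ lim).
  apply: cvg_near_cst; near=> t.
  have bt : basis_of (A 0 k + A t k) [seq ep t i | i <- enum 'I_2] by near: t.
  apply: span2_normal; rewrite -(frame2_span bt).
  by rewrite -vD (proj1 (uP k)) (subvP (addvSl _ _)) ?memv_line.
have dim_vd k : \dim (vertex_deco D k) = 2%N by have [] := subspace_cvg_dim (dv k).
have dim_sd k : \dim (side_deco D k) = 1%N by have [] := subspace_cvg_dim (ds k).
have vP k := dim2_span2 (dim_vd k) (udeco k) (proj2 (uP k)).
have eP k := dim1_vpick (dim_sd k).
have nc k : noncollinear <[u k]>%VS <[u (k + 1)%R]>%VS <[u (k + 2)%R]>%VS.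
  by rewrite -!(proj1 (uP _)) vD; have [_] := gp k.
exists u, (fun k => vpick (vertex_deco D k :\: <[u k]>)%VS).
exists (fun k => vpick (side_deco D k)).
split=> k; [by case: (uP k)|by case: (vP k)|by case: (eP k)|by case: (vP k)
  |by case: (noncollinear_cross (nc k))| |by case: (eP k)].
have -> : k + 1 = k - 1 + 2 by ring.
by have [_] := noncollinear_cross (nc (k - 1)).
Unshelve. all: end_near. Qed.

Lemma motion_side_neq0 x y z : cross x z != 0 -> cross x y != 0 ->
  (<[x]> + <[z]>)%VS <> (<[x]> + <[y]>)%VS :> flat R -> dot z (cross x y) != 0.
Proof.
move=> xz xy ne; apply/eqP => zn; apply: ne.
apply: (plane_normal_inj xy); do ?by apply/eqP; rewrite dim_span2.
  move=> w /memv_addP[_ /vlineP[a ->] [_ /vlineP[b ->] ->]].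
  by rewrite dotDl !dotZl zn dot_cross_l !mulr0 addr0.
by move=> w /span2_normal.
Qed.

Lemma vline_neq_cross x y : x != 0 -> y != 0 ->
  <[x]>%VS <> <[y]>%VS :> flat R -> cross x y != 0.
Proof.
move=> x0 y0 ne; apply/eqP => z; apply: ne; apply/eqP.
by rewrite eqEdim -memvE cross0_vline // !dim_vline x0 leq_b1.
Qed.

Lemma coord_neq0 D u v e k : coordinates D u v e -> u k != 0.
Proof.
move=> cD; apply: contraNneq (coord_motion cD k) => ->.
by apply/eqP; vector_ring.
Qed.

Definition speed_ratio (u v e : int -> 'rV[R]_3) k : R :=
  - (dot (e (up_half h k)) (cross (v k) (u (k + 1)))
     / dot (e (up_half h k)) (cross (u k) (v (k + 1)))).

(** Transversality enters here: the vertices must leave the side for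
[line_decoration_ratio] to apply, and the ratio is finite and nonzero because
the decoration of the side is not one of its endpoints. *)
Lemma speed_ratioP A D u v e k s f s' f' :
  coordinates D u v e -> transverse D -> induces n A D ->
  (\forall t \near 0^', A t k = <[f t]>%VS) ->
  (\forall t \near 0^', A t (k + 1) = <[f' t]>%VS) ->
  (\forall t \near 0^', s t != 0) -> (\forall t \near 0^', s' t != 0) ->
  first_order 0^' s f (u k) (v k) ->
  first_order 0^' s' f' (u (k + 1)) (v (k + 1)) ->
  s' t / s t @[t --> 0^'] --> speed_ratio u v e k /\ speed_ratio u v e k != 0.
Proof.
move=> cD [trv tre] [_ vD _ ds] gf gf' s0 s'0 fo fo'.
have sideE (B : polygon R h) : side B (up_half h k) = (B k + B (k + 1)%R)%VS.
  by rewrite /side down_up_half up_up_half.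
have A0 i : A 0 i = <[u i]>%VS by rewrite -vD (vertex_coord cD).
apply: (line_decoration_ratio (gamma := fun t => A t k)
    (gamma' := fun t => A t (k + 1)) (f := f) (f' := f')) => //.
- rewrite -(side_deco_coord cD).
  rewrite (_ : (fun t => _) = fun t => side (A t) (up_half h k)) //.
  by apply/funext => t; rewrite sideE.
- exact: (coord_side cD).
- have [_] := trv k; rewrite sideE (vertex_deco_coord cD) !(vertex_coord cD).
  by apply: motion_side_neq0; [exact: (coord_motion cD)|exact: (coord_side cD)].
- have [ne _] := trv (k + 1); move: ne.
  have -> : down_half h (k + 1) = up_half h k by rewrite down_halfS.
  rewrite sideE (vertex_deco_coord cD) !(vertex_coord cD).
  rewrite [(<[u k]> + _)%VS]addvC => ne.
  have -> : dot (v (k + 1)) (cross (u k) (u (k + 1))) =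
      - dot (v (k + 1)) (cross (u (k + 1)) (u k)) by vector_ring.
  rewrite oppr_eq0; apply: motion_side_neq0 ne; first exact: (coord_motion cD).
  apply: contra_neq (coord_side cD k) => z.
  by rewrite -[RHS]oppr0 -z; vector_ring.
- apply: vline_neq_cross; [exact: (coord_side_deco cD)|exact: (coord_neq0 _ cD)|].
  rewrite -(side_deco_coord cD) -(vertex_coord cD).
  by have [ne _] := tre (up_half h k); rewrite down_up_half in ne.
- apply: vline_neq_cross; [exact: (coord_side_deco cD)|exact: (coord_neq0 _ cD)|].
  rewrite -(side_deco_coord cD) -(vertex_coord cD).
  by have [_ ne] := tre (up_half h k); rewrite up_up_half in ne.
Qed.

(** The speeds of consecutive vertices have a ratio determined by the
decorations; multiplying these ratios along the polygon lets a single scale [s]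
serve all vertices. The coefficients [c] are chosen before the curve, which is
what makes two curves with the same decorations comparable. *)
Lemma common_scale A0 D u v e k0 :
  induces n A0 D -> coordinates D u v e -> transverse D ->
  exists2 c : nat -> R, (forall m, c m != 0) &
  forall A, induces n A D ->
  exists (s : R -> R) (f : nat -> R -> 'rV[R]_3),
    forall m, (\forall t \near 0^', A t (k0 + m%:Z) = <[f m t]>%VS) /\
      first_order 0^' s (f m) (u (k0 + m%:Z)) (c m *: v (k0 + m%:Z)).
Proof.
move=> A0D cD trD; pose r := speed_ratio u v e.
have lifts A : induces n A D ->
    exists sf : int -> (R -> R) * (R -> 'rV[R]_3), forall k,
    [/\ \forall t \near 0^', (sf k).1 t != 0,
        \forall t \near 0^', A t k = <[(sf k).2 t]>%VS
      & first_order 0^' (sf k).1 (sf k).2 (u k) (v k)].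
  move=> AD; have [_ sm] := induces_at0 AD; case: AD => _ vD dv _.
  have lift k := point_decoration_first_order (gamma := fun t => A t k) (u := u k)
    (v := v k) (sm k).
  suff /choice[sf sfP] k : exists sf : (R -> R) * (R -> 'rV[R]_3),
    [/\ \forall t \near 0^', sf.1 t != 0,
        \forall t \near 0^', A t k = <[sf.2 t]>%VS
      & first_order 0^' sf.1 sf.2 (u k) (v k)] by exists sf.
  apply: lift; [|rewrite -(vertex_deco_coord cD) //|exact: (coord_motion cD)].
  by rewrite -vD (vertex_coord cD).
have r0 k : r k != 0.
  have [sf sfP] := lifts _ A0D.
  have [[s0 g0 fo0] [s1 g1 fo1]] := (sfP k, sfP (k + 1)).
  by have [] := speed_ratioP cD trD A0D g0 g1 s0 s1 fo0 fo1.
exists (fun m => \prod_(i < m) r (k0 + i%:Z)) => [m|A AD].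
  by apply/prodf_neq0.
have [sf sfP] := lifts _ AD.
exists (sf k0).1, (fun m => (sf (k0 + m%:Z)).2) => m.
have [s0 As fo] := sfP (k0 + m%:Z); split=> //.
apply: first_order_rescale fo s0 _.
have [s00 _ _] := sfP k0.
elim: m {As} => [|m IH].
  rewrite big_ord0 addr0; apply: cvg_near_cst; near=> t.
  by rewrite divff //; near: t.
have [sm As fo] := sfP (k0 + m%:Z).
have [sm1 As1 fo1] := sfP (k0 + m.+1%:Z).
have kE : k0 + m.+1%:Z = k0 + m%:Z + 1 by rewrite -addn1 PoszD addrA.
rewrite kE in sm1 As1 fo1 *.
have [lim _] := speed_ratioP cD trD AD As As1 sm sm1 fo fo1.
rewrite big_ord_recr /=; apply: cvg_trans (cvgM IH lim); apply: near_eq_cvg.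
near=> t => /=; rewrite mulrC mulrA mulfVK //; near: t; exact: sm.
Unshelve. all: end_near. Qed.

End Polygons.

(** * The image under the pentagram map *)

Section Pentagram.
Context {R : realType} (h : bool) (n : nat).
Implicit Types (A : R -> polygon R h) (D : decorated R h) (k : int).

Lemma short_diagonal_coord D u v e k : coordinates D u v e ->
  short_diagonal (vertex D) k = (<[u (k - 1)%R]> + <[u (k + 1)%R]>)%VS /\
  \dim (short_diagonal (vertex D) k) = 2%N.
Proof.
move=> cD; rewrite /short_diagonal !(vertex_coord cD); split=> //.
by apply/eqP; rewrite dim_span2 (coord_diagonal cD).
Qed.

(** The lines b_i, i >= k0, in the dual plane: normals [M] and velocities [M'] of
these normals that are common to all the curves inducing [D], only the scale
[s] depending on the curve. *)
Definition diagonal_expansion D k0 (M M' : nat -> 'rV[R]_3) : Prop :=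
  (forall j, [/\ M j != 0, cross (M j) (M' j) != 0,
     \dim (short_diagonal (vertex D) (k0 + j%:Z)) = 2%N &
     forall x, x \in short_diagonal (vertex D) (k0 + j%:Z) -> dot x (M j) = 0]) /\
  forall A, induces n A D -> exists (s : R -> R) (N : nat -> R -> 'rV[R]_3),
    forall j, (\forall t \near 0^', forall x,
        x \in short_diagonal (A t) (k0 + j%:Z) -> dot x (N j t) = 0) /\
      first_order 0^' s (N j) (M j) (M' j).

Lemma diagonal_expansion_exists A0 D u v e k0 : induces n A0 D ->
  coordinates D u v e -> transverse D ->
  (forall k, ~ (vertex_deco D (k - 1) = short_diagonal (vertex D) k /\
                vertex_deco D (k + 1) = short_diagonal (vertex D) k)) ->
  exists M M', diagonal_expansion D k0 M M'.
Proof.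
move=> A0D cD trD nst; have [c c0 scale] := common_scale (k0 - 1) A0D cD trD.
have km j : k0 + j%:Z - 1 = k0 - 1 + j%:Z by rewrite addrAC.
have kp j : k0 + j%:Z + 1 = k0 - 1 + j.+2%:Z by rewrite -addn2 PoszD; ring.
pose M j := cross (u (k0 - 1 + j%:Z)) (u (k0 - 1 + j.+2%:Z)).
pose M' j := cross (c j *: v (k0 - 1 + j%:Z)) (u (k0 - 1 + j.+2%:Z))
   + cross (u (k0 - 1 + j%:Z)) (c j.+2 *: v (k0 - 1 + j.+2%:Z)).
have M0 j : M j != 0 by rewrite /M -km -kp (coord_diagonal cD).
have dM j x : x \in short_diagonal (vertex D) (k0 + j%:Z) -> dot x (M j) = 0.
  by rewrite (proj1 (short_diagonal_coord _ cD)) km kp => /span2_normal.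
have d2 j := proj2 (short_diagonal_coord (k0 + j%:Z) cD).
exists M, M'; split=> [j|A AD]; first (split=> //; last exact: dM); last first.
  have [s [f sf]] := scale A AD.
  exists s, (fun j t => cross (f j t) (f j.+2 t)) => j.
  have [[g1 fo1] [g2 fo2]] := (sf j, sf j.+2); split; last exact: first_order_cross.
  near=> t; move=> x; rewrite /short_diagonal km kp.
  have -> : A t (k0 - 1 + j%:Z) = <[f j t]>%VS by near: t.
  have -> : A t (k0 - 1 + j.+2%:Z) = <[f j.+2 t]>%VS by near: t.
  exact: span2_normal.
apply/eqP => /(cross_velocity_eq0 (M0 j)); rewrite !dotZl -/(M j).
case=> /eqP; rewrite mulf_eq0 (negPf (c0 _)) /= => /eqP v1.
move=> /eqP; rewrite mulf_eq0 (negPf (c0 _)) /= => /eqP v2.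
have onM k : dot (u k) (M j) = 0 -> dot (v k) (M j) = 0 ->
    vertex_deco D k = short_diagonal (vertex D) (k0 + j%:Z).
  move=> uM vM; apply: (plane_normal_inj (M0 j)) (d2 j) _ (@dM j);
    rewrite (vertex_deco_coord cD).
    by apply/eqP; rewrite dim_span2 (coord_motion cD).
  move=> x /memv_addP[_ /vlineP[a ->] [_ /vlineP[b ->] ->]].
  by rewrite dotDl !dotZl uM vM !mulr0 addr0.
apply: (nst (k0 + j%:Z)); rewrite km kp; split; apply: onM => //.
  exact: dot_cross_l.
exact: dot_cross_r.
Unshelve. all: end_near. Qed.

Lemma pentagram_side_sub (B : polygon R h) k :
  (side (pentagram B) k <= short_diagonal B k)%VS.
Proof.
rewrite /side /pentagram subv_add.
have -> : down_half (~~ h) (up_half (~~ ~~ h) k) = k.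
  by rewrite -{1}[~~ h]negbK down_up_half.
have -> : up_half (~~ h) (down_half (~~ ~~ h) k) = k.
  by rewrite -{1}[~~ h]negbK up_down_half.
by rewrite capvSr capvSl.
Qed.

(** The decoration lies on b_i and on its infinitesimal displacement, and by
nonstationarity these two lines are distinct. *)
Lemma side_deco_pentagram D k0 M M' j A DB : diagonal_expansion D k0 M M' ->
  induces n A D -> induces n (fun t => pentagram (A t)) DB ->
  side_deco DB (k0 + j%:Z) = <[cross (M j) (M' j)]>%VS.
Proof.
move=> [MP exA] AD [_ _ _ ds]; have [s [N NP]] := exA A AD.
have [[M0 MM' _ dM] [dN fo]] := (MP j, NP j).
have vD : vertex D = A 0 by case: AD.
apply: line_normals_eq => //; first by have [] := subspace_cvg_dim (ds (k0 + j%:Z)).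
apply: (first_order_ortho (ds (k0 + j%:Z)) fo).
near=> t; move=> x; rewrite memv_cap => /andP[x0 xt]; split.
  by apply: dM; rewrite vD; apply: subvP (pentagram_side_sub _ _) _ x0.
have Nt : forall x, x \in short_diagonal (A t) (k0 + j%:Z) -> dot x (N j t) = 0.
  by near: t.
by apply: Nt; apply: subvP (pentagram_side_sub _ _) _ xt.
Unshelve. all: end_near. Qed.

(** Dually, the decoration contains the vertex [b] of the image and its velocity
[b'], computed by the product rule from the two lines that meet there. If [b']
were parallel to [b], both lines would turn about the vertex. *)
Lemma vertex_deco_pentagram D k M M' A DB (b := cross (M 0%N) (M 1%N))
    (b' := cross (M' 0%N) (M 1%N) + cross (M 0%N) (M' 1%N)) :
  diagonal_expansion D (down_half (~~ h) k) M M' ->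
  induces n A D -> induces n (fun t => pentagram (A t)) DB ->
  ~ (side_deco DB (down_half (~~ h) k) = vertex DB k /\
     side_deco DB (up_half (~~ h) k) = vertex DB k) ->
  cross b b' != 0 /\ forall x, x \in vertex_deco DB k -> dot x (cross b b') = 0.
Proof.
move=> dE AD BD nst; have [MP exA] := dE.
have [s [N NP]] := exA A AD.
have vD : vertex D = A 0 by case: AD.
have [[_ gpB] _] := induces_at0 BD.
have dimB : \dim (pentagram (A 0) k) = 1%N by have [[]] := gpB k.
have sd0 := side_deco_pentagram 0 dE AD BD.
have sd1 := side_deco_pentagram 1 dE AD BD.
case: BD => _ vDB dvB _; rewrite vDB in nst.
have upE : up_half (~~ h) k = down_half (~~ h) k + 1 by exact: up_halfE.
rewrite addr0 in sd0; rewrite -upE in sd1.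
have [M0 MM0] := MP 0%N; have [M1 MM1] := MP 1%N.
rewrite addr0 -upE vD => dim1 dM1 dim0 dM0.
have [dN0 fo0] := NP 0%N; have [dN1 fo1] := NP 1%N.
rewrite addr0 in dN0; rewrite -upE in dN1.
have Bdot x : x \in pentagram (A 0) k -> dot x (M 0%N) = 0 /\ dot x (M 1%N) = 0.
  by rewrite memv_cap => /andP[/dM0 ? /dM1].
have b0 : b != 0.
  apply/eqP => z; have /vlineP[a Ma] := cross0_vline M1 z.
  have E : short_diagonal (A 0) (down_half (~~ h) k) =
      short_diagonal (A 0) (up_half (~~ h) k).
    apply: (plane_normal_inj M0) => // x /dM1 xM.
    by rewrite Ma dotZr xM mulr0.
  by move: dimB; rewrite /pentagram E capvv dim1.
have Bb : pentagram (A 0) k = <[b]>%VS by exact: line_normals_eq.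
have bb' : cross b b' != 0.
  apply/eqP => /(cross_velocity_eq0 b0)[z0 z1]; apply: nst.
  rewrite sd0 sd1 Bb; split; apply/esym; apply: line_normals_eq => //;
    rewrite ?dim_vline ?b0 // => x /vlineP[a ->]; rewrite !dotZl.
    by rewrite [dot b _]dotC dot_cross_l [dot b _]dotC z0 !mulr0.
  by rewrite [dot b _]dotC dot_cross_r [dot b _]dotC z1 !mulr0.
split=> // x xV.
have fob : first_order 0^' s (fun t => cross (N 0%N t) (N 1%N t)) b b'.
  exact: first_order_cross.
apply: (subspace_cvg_ortho (dvB k) (cvg_cross (cvg_cst b) fob.2)) xV.
near=> t => _ /memv_addP[p pB [q qB ->]].
have dN0t : forall x, x \in short_diagonal (A t) (down_half (~~ h) k) ->
    dot x (N 0%N t) = 0 by near: t.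
have dN1t : forall x, x \in short_diagonal (A t) (up_half (~~ h) k) ->
    dot x (N 1%N t) = 0 by near: t.
set bt := cross (N 0%N t) (N 1%N t).
have pb : cross p b = 0.
  by rewrite cross_cross; have [-> ->] := Bdot p pB; rewrite !scale0r subr0.
have qb : cross q bt = 0.
  move: qB; rewrite memv_cap => /andP[/dN0t z0 /dN1t z1].
  by rewrite cross_cross z0 z1 !scale0r subr0.
have -> : dot (p + q) (cross b ((s t)^-1 *: (bt - b))) =
    (s t)^-1 * (dot (cross p b) bt - dot (cross q bt) b).
  by move: bt b {b0 b' Bb bb' fob pb qb} => bt' b1; vector_ring.
by rewrite pb qb !dotE !mxE !mul0r !addr0 subrr mulr0.
Unshelve. all: end_near. Qed.

End Pentagram.

Theorem proposition6p6 (R : realType) (h : bool) (n : nat)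
    (A1 A2 : R -> polygon R h) (DA : decorated R h)
    (DB1 DB2 : decorated R (~~ h)) :
  (0 < n)%N ->
  induces n A1 DA ->
  induces n A2 DA ->
  induces n (fun t => pentagram (A1 t)) DB1 ->
  induces n (fun t => pentagram (A2 t)) DB2 ->
  transverse DA ->
  nonstationary DA DB1 ->
  DB1 = DB2.
Proof.
move=> _ iA1 iA2 iB1 iB2 trA [nsA nsB].
have [u [v [e cA]]] := induces_coordinates iA1.
have expand k := diagonal_expansion_exists k iA1 cA trA nsA.
have vB : vertex DB1 = vertex DB2.
  case: iA1 iA2 iB1 iB2 => [_ vA1 _ _] [_ vA2 _ _] [_ -> _ _] [_ -> _ _].
  by rewrite -vA1 -vA2.
have sB : side_deco DB1 = side_deco DB2.
  apply/funext => k; have [M [M' dE]] := expand k.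
  have := side_deco_pentagram 0 dE iA1 iB1.
  by rewrite -(side_deco_pentagram 0 dE iA2 iB2) addr0.
have dB : vertex_deco DB1 = vertex_deco DB2.
  apply/funext => k; have [M [M' dE]] := expand (down_half (~~ h) k).
  have [n0 ort1] := vertex_deco_pentagram dE iA1 iB1 (nsB k).
  have [|_ ort2] := vertex_deco_pentagram dE iA2 iB2 (k := k).
    by rewrite -sB -vB; exact: nsB.
  case: iB1 iB2 => [_ _ dv1 _] [_ _ dv2 _].
  apply: plane_normal_inj n0 _ _ ort1 ort2.
    by have [] := subspace_cvg_dim (dv1 k).
  by have [] := subspace_cvg_dim (dv2 k).
by case: DB1 DB2 vB sB dB {iB1 iB2 nsB} => [? ? ?] [? ? ?] /= -> -> ->.
Qed.
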